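(* Let $\Phi=(G,\varphi)$ be a connected $\mathbb{T}$-gain graph with vertex set $V(G)=\{v_1,\dots,v_n\}$. Then $\Phi$ is not vertex order-independent if and only if at least one of the following holds: (i) there exist vertices $v_s,v_t\in V(G)$ such that $\mathcal{P}^{\max}(v_s,v_t)$ contains at least two oriented paths from $v_s$ to $v_t$ having different gains; (ii) there exist vertices $v_s,v_t\in V(G)$ such that $\mathcal{P}^{\min}(v_s,v_t)$ contains at least two oriented paths from $v_s$ to $v_t$ having different gains.
   Context: $\mathbb{T}=\{z\in\mathbb{C}:|z|=1\}$. A $\mathbb{T}$-gain graph $\Phi=(G,\varphi)$ on a simple graph $G$ is a map $\varphi$ assigning to each oriented edge $\overrightarrow{e}_{s,t}$ (for each edge $e_{s,t}$ of $G$) an element of $\mathbb{T}$ with $\varphi(\overrightarrow{e}_{t,s})=\varphi(\overrightarrow{e}_{s,t})^{-1}$. The gain $\varphi(sPt)$ of an oriented path $sPt$ from $s$ to $t$ is the product of the gains of its consecutive oriented edges. $d(s,t)$ is the graph distance in $G$. For $s,t\in V(G)$: $\mathcal{P}(s,t)$ is the set of oriented shortest paths from $s$ to $t$; $\mathcal{P}^{\max}(s,t)$ (resp. $\mathcal{P}^{\min}(s,t)$) is the set of $sPt\in\mathcal{P}(s,t)$ whose gain has maximum (resp. minimum) real part among all paths in $\mathcal{P}(s,t)$. Given a total order $<$ on $V(G)$, define $\varphi^{<}_{\max}(s,t)$ for $s<t$ as the gain $\varphi(sPt)$ of a path $sPt\in\mathcal{P}^{\max}(s,t)$ whose gain has maximum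 imaginary part among paths in $\mathcal{P}^{\max}(s,t)$, and $\varphi^{<}_{\max}(t,s)=\overline{\varphi^{<}_{\max}(s,t)}$; similarly $\varphi^{<}_{\min}(s,t)$ for $s<t$ is the gain of a path in $\mathcal{P}^{\min}(s,t)$ whose gain has minimum imaginary part among paths in $\mathcal{P}^{\min}(s,t)$, and $\varphi^{<}_{\min}(t,s)=\overline{\varphi^{<}_{\min}(s,t)}$. The gain distance matrices are $D^{\max}_{<}(\Phi)=(\varphi^{<}_{\max}(v_i,v_j)d(v_i,v_j))_{i,j}$ and $D^{\min}_{<}(\Phi)=(\varphi^{<}_{\min}(v_i,v_j)d(v_i,v_j))_{i,j}$. The standard order is $v_1<v_2<\dots<v_n$, and $<_r$ denotes its reverse. $\Phi$ is vertex order-independent if $D^{\max}_{<}(\Phi)=D^{\max}_{<_r}(\Phi)$ and $D^{\min}_{<}(\Phi)=D^{\min}_{<_r}(\Phi)$ for the standard order $<$. *)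

(* Defs.v *)
From HB Require Import structures.
From mathcomp Require Import all_boot all_order all_algebra.
From mathcomp Require Import reals.
From mathcomp Require Export complex.

Set Implicit Arguments.
Unset Strict Implicit.
Unset Printing Implicit Defensive.

Import Order.TTheory GRing.Theory Num.Theory.
Local Open Scope ring_scope.

(* The vertices v_1, ..., v_n are the elements of 'I_n, and R[i] is the field
   of complex numbers.  [gain s t] is the gain of the edge st oriented from s to
   t; it is unconstrained, and never used, when s and t are not adjacent. *)
Record gain_graph (R : realType) (n : nat) := GainGraph {
  edge : rel 'I_n;
  edge_sym : symmetric edge;
  edge_irr : irreflexive edge;
  gain : 'I_n -> 'I_n -> R[i];
  gain_norm : forall s t, edge s t -> `|gain s t| = 1;
  gain_inv : forall s t, edge s t -> gain t s = (gain s t)^-1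
}.

Section GainGraph.
Variables (R : realType) (n : nat) (Phi : gain_graph R n).

Definition connected_graph := forall s t : 'I_n, connect (edge Phi) s t.

(* An oriented path from s is represented by the sequence p of its vertices
   other than s, so [size p] is its number of edges. *)
Definition is_path (s t : 'I_n) (p : seq 'I_n) : bool :=
  [&& path (edge Phi) s p, uniq (s :: p) & last s p == t].

Fixpoint path_gain (s : 'I_n) (p : seq 'I_n) : R[i] :=
  if p is t :: p' then gain Phi s t * path_gain t p' else 1.

(* The least length of a path from s to t: a path has fewer than n edges.
   The value is n if there is no path. *)
Definition dist (s t : 'I_n) : nat :=
  find (fun k => [exists p : k.-tuple 'I_n, is_path s t p]) (iota 0 n).

Definition shortest_paths (s t : 'I_n) : {set (dist s t).-tuple 'I_n} :=
  [set p : (dist s t).-tuple 'I_n | is_path s t p].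

Definition Pmax (s t : 'I_n) : {set (dist s t).-tuple 'I_n} :=
  [set p in shortest_paths s t | [forall q in shortest_paths s t,
     complex.Re (path_gain s q) <= complex.Re (path_gain s p)]].

Definition Pmin (s t : 'I_n) : {set (dist s t).-tuple 'I_n} :=
  [set p in shortest_paths s t | [forall q in shortest_paths s t,
     complex.Re (path_gain s p) <= complex.Re (path_gain s q)]].

(* The choice of the path does not matter: its gain is determined by its real
   and imaginary parts.  The value 0 is taken only if there is no path. *)
Definition max_gain (s t : 'I_n) : R[i] :=
  if [pick p in Pmax s t | [forall q in Pmax s t,
        complex.Im (path_gain s q) <= complex.Im (path_gain s p)]] is Some p
  then path_gain s p else 0.

Definition min_gain (s t : 'I_n) : R[i] :=
  if [pick p in Pmin s t | [forall q in Pmin s t,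
        complex.Im (path_gain s p) <= complex.Im (path_gain s q)]] is Some p
  then path_gain s p else 0.

(* [lt] is a strict total order on the vertices.  The last branch is the case
   s = t, where the only path is trivial, with gain 1. *)
Definition phi_max (lt : rel 'I_n) (s t : 'I_n) : R[i] :=
  if lt s t then max_gain s t
  else if lt t s then conjc (max_gain t s) else 1.

Definition phi_min (lt : rel 'I_n) (s t : 'I_n) : R[i] :=
  if lt s t then min_gain s t
  else if lt t s then conjc (min_gain t s) else 1.

Definition Dmax (lt : rel 'I_n) : 'M[R[i]]_n :=
  \matrix_(i < n, j < n) (phi_max lt i j * (dist i j)%:R).

Definition Dmin (lt : rel 'I_n) : 'M[R[i]]_n :=
  \matrix_(i < n, j < n) (phi_min lt i j * (dist i j)%:R).

Definition std_lt : rel 'I_n := fun i j => (i < j)%N.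
Definition rev_lt : rel 'I_n := fun i j => std_lt j i.

Definition vertex_order_independent : Prop :=
  Dmax std_lt = Dmax rev_lt /\ Dmin std_lt = Dmin rev_lt.

End GainGraph.

(* Main.v *)
Require Import Defs.
From mathcomp Require Import all_boot all_order all_algebra.
From mathcomp Require Import reals.

(** Reversing a path conjugates its gain, hence gives a bijection from
    P^max(s,t) to P^max(t,s) preserving real parts and negating imaginary parts.
    So phi_max(s,t) computed in the order with s < t is the gain of largest
    imaginary part in P^max(s,t), and computed in the reverse order it is the one
    of smallest imaginary part.  As the real part is constant on P^max(s,t), the
    two agree iff all gains in P^max(s,t) coincide.  The case of P^min is the
    same for the opposite order on R. *)

Set Implicit Arguments.
Unset Strict Implicit.
Unset Printing Implicit Defensive.

Import Order.TTheory GRing.Theory Num.Theory.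
Local Open Scope ring_scope.

Section Reversal.
Variables (R : realType) (n : nat) (Phi : gain_graph R n).
Implicit Types (s t : 'I_n) (p q : seq 'I_n).

Lemma gain_conjc s t : edge Phi s t -> gain Phi t s = conjc (gain Phi s t).
Proof.
move=> est; rewrite (gain_inv est).
by rewrite (invC_norm (gain Phi s t)) (gain_norm est) expr1n invr1 mul1r.
Qed.

Lemma path_gain_rcons s p t :
  path_gain Phi s (rcons p t) = path_gain Phi s p * gain Phi (last s p) t.
Proof.
elim: p s => [|u p IHp] s /=; first by rewrite mulr1 mul1r.
by rewrite IHp mulrA.
Qed.

(** [belast s p] lists all vertices of the path but the last, so its reverse encodes the reversed
    path started at [last s p]. Each edge gain is conjugated because inversion is conjugation on the
    unit circle. *)
Lemma path_gain_rev s p : path (edge Phi) s p ->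
  path_gain Phi (last s p) (rev (belast s p)) = conjc (path_gain Phi s p).
Proof.
elim: p s => [|u p IHp] s /=; first by rewrite oppr0.
case/andP=> esu pp; rewrite rev_cons path_gain_rcons (IHp _ pp) [RHS]rmorphM mulrC.
congr (_ * _); rewrite /= -(gain_conjc esu); congr (gain Phi _ s).
(* What remains is that the reversed tail ends at [u]. *)
by case: p {IHp pp} => //= v p; rewrite rev_cons last_rcons.
Qed.

Lemma is_path_rev s t p :
  is_path Phi s t p -> is_path Phi t s (rev (belast s p)).
Proof.
case/and3P=> pp up /eqP <-; apply/and3P; split.
- by rewrite rev_path (eq_path (e' := edge Phi)) // => x y; rewrite edge_sym.
- by rewrite -rev_rcons -lastI rev_uniq.
- by case: p {pp up} => //= u p; rewrite rev_cons last_rcons.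
Qed.

(** A nonempty [p] would contain its last vertex [s], against the distinctness of the vertices. *)
Lemma is_path_self s p : is_path Phi s s p -> p = [::].
Proof.
case/and3P=> _; case: p => //= u p /andP[+ _] /eqP sE.
by rewrite -{1}sE mem_last.
Qed.

Lemma dist_sym s t : dist Phi s t = dist Phi t s.
Proof.
apply: eq_find => k.
have sz u (p : k.-tuple 'I_n) : size (rev (belast u p)) == k.
  by rewrite size_rev size_belast size_tuple.
by apply/existsP/existsP => -[p /is_path_rev pP];
  [exists (Tuple (sz s p)) | exists (Tuple (sz t p))].
Qed.

Lemma shortest_paths_rev s t (p : (dist Phi s t).-tuple 'I_n) :
  p \in shortest_paths Phi s t ->
  exists2 q : (dist Phi t s).-tuple 'I_n, q \in shortest_paths Phi t s
    & path_gain Phi t q = conjc (path_gain Phi s p).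
Proof.
rewrite inE => pP.
have sz : size (rev (belast s p)) == dist Phi t s.
  by rewrite size_rev size_belast size_tuple dist_sym.
exists (Tuple sz); first by rewrite inE is_path_rev.
by case/and3P: pP => pp _ /eqP {1}<-; apply: path_gain_rev.
Qed.

Hypothesis conn : connected_graph Phi.

(** A walk given by connectedness shortens to one without repeated vertices, which has fewer than
    [n] edges, so the bounded search in [dist] succeeds. *)
Lemma shortest_paths_neq0 s t :
  exists p : (dist Phi s t).-tuple 'I_n, p \in shortest_paths Phi s t.
Proof.
have /connectP[p0 pp0 ->] := conn s t.
case: (shortenP pp0) => p pp up _; set u := last s p.
have szp : (size p < n)%N.
  by have := uniq_leq_size up (fun x _ => mem_enum 'I_n x); rewrite size_enum_ord.
have hasp : has (fun k => [exists q : k.-tuple 'I_n, is_path Phi s u q])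
    (iota 0 n).
  apply/hasP; exists (size p); first by rewrite mem_iota.
  by apply/existsP; exists (in_tuple p); apply/and3P.
(* The lengths searched are 0, 1, ..., so the position returned by [find] is itself the length
   found. *)
have := nth_find 0%N hasp; rewrite nth_iota -?[X in (_ < X)%N](size_iota 0 n) -?has_find //.
by rewrite add0n => /existsP[q qP]; exists q; rewrite inE.
Qed.

(** This allows the distance factor to be cancelled in off-diagonal entries. *)
Lemma dist_neq0 s t : s != t -> dist Phi s t != 0%N.
Proof.
have [p] := shortest_paths_neq0 s t; rewrite inE => /and3P[_ _ /eqP lastE].
apply: contraNneq => d0; rewrite -lastE.
by have /size0nil-> : size p = 0%N by rewrite size_tuple.
Qed.

End Reversal.

Section Extremal.
Variables (R : realType) (n : nat) (Phi : gain_graph R n).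
Hypothesis conn : connected_graph Phi.
Variable le : rel R.
Hypotheses (le_refl : reflexive le) (le_anti : antisymmetric le).
Hypotheses (le_trans : transitive le) (le_total : total le).
Hypothesis leN : forall x y, le (- x) (- y) = le y x.
Implicit Types s t : 'I_n.

(* [Pmax], [max_gain], [phi_max] and [Dmax] are convertible to the instances of
   the next definitions at [fun x y => x <= y], and their [min] counterparts to
   the instances at [fun x y => y <= x]. *)
Definition Pext s t : {set (dist Phi s t).-tuple 'I_n} :=
  [set p in shortest_paths Phi s t | [forall q in shortest_paths Phi s t,
     le (complex.Re (path_gain Phi s q)) (complex.Re (path_gain Phi s p))]].

Definition ext_gain s t : R[i] :=
  if [pick p in Pext s t | [forall q in Pext s t,
        le (complex.Im (path_gain Phi s q)) (complex.Im (path_gain Phi s p))]]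
    is Some p
  then path_gain Phi s p else 0.

Definition phi_ext (lt : rel 'I_n) s t : R[i] :=
  if lt s t then ext_gain s t
  else if lt t s then conjc (ext_gain t s) else 1.

Definition Dext (lt : rel 'I_n) : 'M[R[i]]_n :=
  \matrix_(i < n, j < n) (phi_ext lt i j * (dist Phi i j)%:R).

(** A boolean, so that its failure produces explicit paths and the final disjunction can be settled
    by cases. *)
Definition Pext_constant : bool :=
  [forall s, forall t, forall p in Pext s t, forall q in Pext s t,
     path_gain Phi s p == path_gain Phi s q].

Lemma exists_greatest (T : finType) (A : {set T}) (f : T -> R) (x : T) :
  x \in A -> exists2 y, y \in A & [forall z in A, le (f z) (f y)].
Proof.
(* [extremumP] gives an element whose value precedes all the others, hence the passage to the
   converse relation. *)
move=> xA; pose ge a b := le b a.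
have ge_trans : transitive ge by move=> a b c /= ba cb; apply: le_trans cb ba.
have ge_total : total ge by move=> a b; apply: le_total.
have [y yA yP] := extremumP (P := mem A) f (le_refl : reflexive ge)
                    ge_trans ge_total xA.
by exists y => //; apply/forall_inP.
Qed.

Lemma Pext_neq0 s t : exists p, p \in Pext s t.
Proof.
have [p0 p0P] := shortest_paths_neq0 conn s t.
have [p pP pmax] :=
  exists_greatest (fun p : _.-tuple _ => complex.Re (path_gain Phi s p)) p0P.
by exists p; rewrite inE pP.
Qed.

(** As [Pext s t] is nonempty and finite, the default value 0 of [ext_gain] is never reached. *)
Lemma ext_gainP s t : exists2 p, p \in Pext s t &
  ext_gain s t = path_gain Phi s p /\
  forall q, q \in Pext s t ->
    le (complex.Im (path_gain Phi s q)) (complex.Im (path_gain Phi s p)).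
Proof.
rewrite /ext_gain; case: pickP => [p /andP[pP /forall_inP pmax]|none].
  by exists p.
have [p0 p0P] := Pext_neq0 s t.
have [p pP pmax] :=
  exists_greatest (fun p : _.-tuple _ => complex.Im (path_gain Phi s p)) p0P.
by have := none p; rewrite pP pmax.
Qed.

Lemma Re_conjc (z : R[i]) : complex.Re (conjc z) = complex.Re z.
Proof. by case: z. Qed.

Lemma Im_conjc (z : R[i]) : complex.Im (conjc z) = - complex.Im z.
Proof. by case: z. Qed.

Lemma Pext_rev s t (p : (dist Phi s t).-tuple 'I_n) : p \in Pext s t ->
  exists2 q : (dist Phi t s).-tuple 'I_n, q \in Pext t s
    & path_gain Phi t q = conjc (path_gain Phi s p).
Proof.
rewrite inE => /andP[pP /forall_inP pmax].
have [q qP qE] := shortest_paths_rev pP; exists q => //.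
(* Reversing a competitor [q'] of [q] gives a competitor of [p] with the same real part. *)
rewrite inE qP; apply/forall_inP => q' /shortest_paths_rev[p' p'P p'E].
by move: (pmax _ p'P); rewrite qE p'E !Re_conjc.
Qed.

Lemma Pext_Re s t (p q : (dist Phi s t).-tuple 'I_n) :
    p \in Pext s t -> q \in Pext s t ->
  complex.Re (path_gain Phi s p) = complex.Re (path_gain Phi s q).
Proof.
rewrite inE => /andP[pP /forall_inP pmax].
rewrite inE => /andP[qP /forall_inP qmax].
by apply: le_anti; rewrite pmax ?qmax.
Qed.

Lemma ext_gain_conjP s t :
  ext_gain s t = conjc (ext_gain t s) <->
  (forall p q, p \in Pext s t -> q \in Pext s t ->
     path_gain Phi s p = path_gain Phi s q).
Proof.
have [p pP [-> pmax]] := ext_gainP s t.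
have [q qP [-> qmax]] := ext_gainP t s.
split=> [pqE|const]; last first.
  by have [q' q'P <-] := Pext_rev qP; apply: const.
suff gainE r : r \in Pext s t -> path_gain Phi s r = path_gain Phi s p.
  by move=> r r' /gainE-> /gainE->.
move=> rP; apply/eqP; rewrite eq_complex (Pext_Re rP pP) eqxx; apply/eqP.
have [r' r'P r'E] := Pext_rev rP.
(* One inequality is the choice of [p]. The other is the choice of [q] tested on the reversal [r']
   of [r], since by [pqE] the gain of [p] is conjugate to that of [q]. *)
apply: le_anti; rewrite pmax // pqE Im_conjc -leN opprK -Im_conjc -r'E.
exact: qmax.
Qed.

(** For distinct [s] and [t], one of the two orders uses [ext_gain s t] and the other the conjugate
    of [ext_gain t s]; on the diagonal both use 1. *)
Lemma Dext_eqP :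
  Dext (@std_lt n) = Dext (@rev_lt n) <->
  (forall s t, s != t -> ext_gain s t = conjc (ext_gain t s)).
Proof.
split=> [DE s t st|gE].
  have := congr1 (fun M : 'M[R[i]]_n => M s t) DE; rewrite !mxE => /mulIf.
  rewrite pnatr_eq0 dist_neq0 // => /(_ isT).
  rewrite /phi_ext /rev_lt /std_lt.
  by case: ltngtP => // /val_inj sE; rewrite sE eqxx in st.
apply/matrixP => s t; rewrite !mxE; congr (_ * _).
rewrite /phi_ext /rev_lt /std_lt.
by case: ltngtP => // lst; [|apply/esym]; apply: gE;
  rewrite -val_eqE neq_ltn lst ?orbT.
Qed.

Lemma Dext_eq_constant : Dext (@std_lt n) = Dext (@rev_lt n) <-> Pext_constant.
Proof.
split=> [/Dext_eqP gE|const].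
  apply/forallP => s; apply/forallP => t.
  apply/forall_inP => p pP; apply/forall_inP => q qP; apply/eqP.
  have [st|st] := eqVneq s t; last exact: (ext_gain_conjP s t).1 (gE _ _ st) _ _ _ _.
  (* [gE] says nothing about the diagonal, where only the empty path occurs. *)
  subst t; move: pP qP; rewrite !inE => /andP[pP _] /andP[qP _].
  by rewrite (is_path_self pP) (is_path_self qP).
apply/Dext_eqP => s t _; apply/ext_gain_conjP => p q pP qP; apply/eqP.
by move: const => /forallP/(_ s)/forallP/(_ t)/forall_inP/(_ p pP)/forall_inP/(_ q qP).
Qed.

Lemma Pext_constantPn :
  reflect (exists (s t : 'I_n) (p q : (dist Phi s t).-tuple 'I_n),
             [/\ p \in Pext s t, q \in Pext s t
               & path_gain Phi s p <> path_gain Phi s q])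
          (~~ Pext_constant).
Proof.
apply: (iffP idP) => [/forallPn[s /forallPn[t]]|[s [t [p [q [pP qP neq]]]]]].
  move=> /forall_inPn[p pP /forall_inPn[q qP /eqP neq]].
  by exists s, t, p, q.
apply/negP => /forallP/(_ s)/forallP/(_ t)/forall_inP/(_ p pP)/forall_inP/(_ q qP).
by move/eqP.
Qed.

End Extremal.

Theorem theorem3p6 (R : realType) (n : nat) (Phi : gain_graph R n)
    (conn : connected_graph Phi) :
  ~ vertex_order_independent Phi <->
  (exists (s t : 'I_n) (p q : (dist Phi s t).-tuple 'I_n),
      [/\ p \in Pmax Phi s t, q \in Pmax Phi s t
        & path_gain Phi s p <> path_gain Phi s q]) \/
  (exists (s t : 'I_n) (p q : (dist Phi s t).-tuple 'I_n),
      [/\ p \in Pmin Phi s t, q \in Pmin Phi s t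
        & path_gain Phi s p <> path_gain Phi s q]).
Proof.
pose le_max := fun x y : R => x <= y; pose le_min := fun x y : R => y <= x.
have maxE : Dmax Phi (@std_lt n) = Dmax Phi (@rev_lt n) <->
    Pext_constant Phi le_max.
  apply: (Dext_eq_constant conn (le := le_max)).
  - exact: lexx.
  - exact: le_anti.
  - exact: le_trans.
  - exact: le_total.
  - exact: lerN2.
have minE : Dmin Phi (@std_lt n) = Dmin Phi (@rev_lt n) <->
    Pext_constant Phi le_min.
  apply: (Dext_eq_constant conn (le := le_min)).
  - exact: lexx.
  - exact: ge_anti.
  - exact: ge_trans.
  - exact: ge_total.
  - by move=> x y; apply: lerN2.
have maxP := Pext_constantPn Phi le_max.
have minP := Pext_constantPn Phi le_min.
rewrite /vertex_order_independent maxE minE; split=> [nindep|].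
  have [cmax|/maxP] := boolP (Pext_constant Phi le_max); last by left.
  by right; apply/minP; apply/negP => cmin; apply: nindep.
by case=> [/maxP/negP nc|/minP/negP nc] [].
Qed.
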